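(* There is an absolute constant $C>0$ such that for all distinct points $x,y\in\mathbb{R}^2$, $$|K(x,y)|\le C\min\left\{\langle y\rangle\Big(1+\frac1{|x-y|}\Big),\ \langle x\rangle\Big(1+\frac1{|x-y|}\Big)\right\},$$ where $$K(x,y)=-\frac1{4\pi}\int_{\mathbb{R}}\frac{(x_1,x_2,0)-(R_a y,a)}{|(x_1,x_2,0)-(R_a y,a)|^3}\wedge\xi(R_a y,a)\,da\in\mathbb{R}^3 .$$
   Context: $\langle x\rangle=(1+|x|^2)^{1/2}$; $\wedge$ is the cross product on $\mathbb{R}^3$; $\xi(x_1,x_2,x_3)=(x_2,-x_1,1)$; for $a\in\mathbb{R}$, $y\in\mathbb{R}^2$, $R_a y=(y_1\cos a+y_2\sin a,\,-y_1\sin a+y_2\cos a)$, and $(R_a y,a)$ denotes the corresponding point of $\mathbb{R}^3$. *)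

(* Defs.v *)
From HB Require Import structures.
From mathcomp Require Import all_boot all_order all_algebra.
From mathcomp Require Import all_classical all_reals all_analysis.

Set Implicit Arguments.
Unset Strict Implicit.
Unset Printing Implicit Defensive.

Import Order.TTheory GRing.Theory Num.Theory.
Import numFieldNormedType.Exports.

Local Open Scope classical_set_scope.
Local Open Scope ring_scope.

(* The Euclidean norm; the norm [`|v|] that MathComp-Analysis puts on 'rV[R]_n
   is the sup norm. *)
Definition enorm (R : realType) (n : nat) (v : 'rV[R]_n) : R :=
  Num.sqrt (\sum_(i < n) v 0 i ^+ 2).

Definition bracket (R : realType) (n : nat) (v : 'rV[R]_n) : R :=
  Num.sqrt (1 + enorm v ^+ 2).

(* Coordinates are numbered from 0: x_1, x_2, x_3 are x 0 0, x 0 1, x 0 2. *)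
Definition vec2 (R : realType) (a b : R) : 'rV[R]_2 :=
  \row_(i < 2) [:: a; b]`_i.

Definition vec3 (R : realType) (a b c : R) : 'rV[R]_3 :=
  \row_(i < 3) [:: a; b; c]`_i.

Definition crossp (R : realType) (u v : 'rV[R]_3) : 'rV[R]_3 :=
  vec3 (u 0 1 * v 0 2 - u 0 2 * v 0 1)
       (u 0 2 * v 0 0 - u 0 0 * v 0 2)
       (u 0 0 * v 0 1 - u 0 1 * v 0 0).

Definition xi (R : realType) (p : 'rV[R]_3) : 'rV[R]_3 :=
  vec3 (p 0 1) (- p 0 0) 1.

Definition rot (R : realType) (a : R) (y : 'rV[R]_2) : 'rV[R]_2 :=
  vec2 (y 0 0 * cos a + y 0 1 * sin a) (- y 0 0 * sin a + y 0 1 * cos a).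

Definition lift3 (R : realType) (y : 'rV[R]_2) (z : R) : 'rV[R]_3 :=
  vec3 (y 0 0) (y 0 1) z.

Definition K_integrand (R : realType) (x y : 'rV[R]_2) (a : R) : 'rV[R]_3 :=
  let p := lift3 (rot a y) a in
  let d := lift3 x 0 - p in
  crossp ((enorm d ^+ 3)^-1 *: d) (xi p).

(* The vector-valued integral is taken componentwise.  For x != y the integrand
   is continuous (d vanishes only if a = 0 and x = y) and O(a^-2) at infinity,
   so each component is Lebesgue integrable on R and [Rintegral] is its
   integral. *)
Definition K (R : realType) (x y : 'rV[R]_2) : 'rV[R]_3 :=
  - (1 / (4 * pi)) *:
    \row_(k < 3)
      (\int[@lebesgue_measure R]_(a in setT) K_integrand x y a 0 k)%R.

(* Main.v *)
Require Import Defs.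
From HB Require Import structures.
From mathcomp Require Import all_boot all_order all_algebra.
From mathcomp Require Import all_classical all_reals all_analysis.
From mathcomp Require Import measurable_realfun ring lra.
Import Order.TTheory GRing.Theory Num.Theory.
Import numFieldNormedType.Exports.
Local Open Scope classical_set_scope.
Local Open Scope ring_scope.

(* Write d = (x, 0) - (R_a y, a), F(a) = |x - R_a y|^2, so |d|^2 = F(a) + a^2,
   and delta = |x - y|, rho = |y|.  The integrand is at most <y> / |d|^2, so the
   bound by <y> follows once 1 / |d|^2 has integral O(1 + 1/delta).

   Let a0 minimize F on [-1, 1].  There the chord |R_a y - R_a0 y| is at most
   2 sqrt(F(a)) and comparable to rho |a - a0|, so F(a) >= c rho^2 (a - a0)^2;
   also delta^2 <= 2 F(a) + 2 rho^2 a^2.  Hence |d|^2 is bounded below by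
   (1 + a^2) / 2 if |a| > 1, by delta^2 / 4 + a^2 if rho |a| <= delta / 2, and
   by delta^2 / (4 rho^2) + c rho^2 (a - a0)^2 otherwise.  The reciprocals are
   Cauchy densities of masses O(1), O(1/delta) and O(1/delta).

   For the bound by <x>: if |y| <= 2 |x| then <y> <= 2 <x>.  Otherwise F is
   comparable to rho^2, and replacing xi(R_a y, a) by xi(x, 0) costs at most
   sqrt(F) / |d|^2 <= 2 rho / (rho^2 / 4 + a^2), which has integral 4 pi. *)

(** * Upper bounds for integrals of nonnegative functions *)

(** The integral is extended-real valued, so the bound by a real [B] carries finiteness with it and
    no separate integrability statement is needed. *)
Definition has_integral_le {R : realType} (g : R -> R) (B : R) : Prop :=
  [/\ measurable_fun setT g, (forall x, 0 <= g x) &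
      (\int[@lebesgue_measure R]_x (g x)%:E <= B%:E)%E].

Lemma has_integral_leD {R : realType} (f g : R -> R) A B :
  has_integral_le f A -> has_integral_le g B ->
  has_integral_le (fun x => f x + g x) (A + B).
Proof.
move=> [mf f0 If] [mg g0 Ig]; split.
- exact: measurable_funD.
- by move=> x; rewrite addr_ge0.
- under eq_integral do rewrite EFinD.
  rewrite ge0_integralD//.
  + by rewrite EFinD leeD.
  + by move=> x _; rewrite lee_fin.
  + exact/measurable_EFinP.
  + by move=> x _; rewrite lee_fin.
  + exact/measurable_EFinP.
Qed.

Lemma has_integral_leZ {R : realType} (f : R -> R) A k : 0 <= k ->
  has_integral_le f A -> has_integral_le (fun x => k * f x) (k * A).
Proof.
move=> k0 [mf f0 If]; split.
- exact: measurable_funM.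
- by move=> x; rewrite mulr_ge0.
- under eq_integral do rewrite EFinM.
  rewrite ge0_integralZl_EFin//.
  + by rewrite EFinM lee_wpmul2l// lee_fin.
  + by move=> x _; rewrite lee_fin.
  + exact/measurable_EFinP.
Qed.

Lemma le_has_integral {R : realType} (f : R -> R) A B : A <= B ->
  has_integral_le f A -> has_integral_le f B.
Proof. by move=> AB [mf f0 If]; split=> //; rewrite (le_trans If)// lee_fin. Qed.

Lemma normr_Rintegral_le {R : realType} (f g : R -> R) B :
  measurable_fun setT f -> has_integral_le g B -> (forall x, `|f x| <= g x) ->
  `|\int[@lebesgue_measure R]_x f x| <= B.
Proof.
move=> mf [mg g0 Ig] fg.
have Hf : (`|\int[@lebesgue_measure R]_x (f x)%:E| <= B%:E)%E.
{ apply: le_trans Ig; apply: le_trans (le_abse_integral _ _ _) _ => //.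
    exact/measurable_EFinP.
  apply: ge0_le_integral => //.
  - by apply/measurable_EFinP; exact: measurableT_comp.
  - exact/measurable_EFinP.
  - by move=> x _; rewrite lee_fin. }
(* [Rintegral] is the finite part of the extended integral; the bound rules out infinite values. *)
by move: Hf; rewrite /Rintegral; case: (integral _ _ _).
Qed.

(** * Masses of Cauchy densities *)

Lemma integral_oneDsqrV {R : realType} :
  (\int[@lebesgue_measure R]_x ((1 + x ^+ 2)^-1)%:E = pi%:E)%E.
Proof.
rewrite (@ge0_symfun_integralT R (fun x : R => (1 + x ^+ 2)^-1)).
- rewrite -set_itvcy (_ : (\int[_]_(x in _) _ = (pi / 2)%:E)%E).
    by rewrite -EFinM mulrCA divff ?mulr1.
  exact: integral0y_oneDsqr.
- by move=> x; rewrite invr_ge0 addr_ge0// sqr_ge0.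
- exact: continuous_oneDsqrV.
- by move=> x /=; rewrite sqrrN.
Qed.

(** The affine substitution u = m (x - t) / p reduces this to the integral of 1 / (1 + u^2). Only
    the product p m enters the mass. *)
Lemma cauchy_has_integral {R : realType} (p m t : R) : 0 < p -> 0 < m ->
  has_integral_le (fun x => (p ^+ 2 + m ^+ 2 * (x - t) ^+ 2)^-1) (pi / (p * m)).
Proof.
move=> p0 m0.
pose k := m / p; have k0 : 0 < k by rewrite divr_gt0.
pose F := fun x : R => k * (x - t).
have dF (x : R) : is_derive x (1 : R) F k.
  rewrite /F; apply: is_derive_eq; rewrite subr0 /GRing.scale/= !mulr1.
  by ring.
have F'E : F^`()%classic = cst k.
  by apply/funext => x; rewrite derive1E; exact: derive_val.
have E : (\int[@lebesgue_measure R]_x ((1 + (F x) ^+ 2)^-1 * k)%:E = pi%:E)%E.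
{ rewrite -integral_oneDsqrV.
  rewrite (@increasing_ge0_integration_by_substitutionT _ F
    (fun x : R => (1 + x ^+ 2)^-1)) ?F'E//.
  - by move=> x y xy; rewrite /F ltr_pM2l// ltrD2r.
  - by move=> x; exact: cst_continuous.
  - exact: is_cvg_cst.
  - exact: is_cvg_cst.
  - by apply: gt0_cvgMrNy => //; exact: cvg_addrr_Ny.
  - by apply: gt0_cvgMry => //; exact: cvg_addrr.
  - exact: continuous_oneDsqrV.
  - by move=> x; rewrite invr_ge0 addr_ge0// sqr_ge0. }
have fE x : (p ^+ 2 + m ^+ 2 * (x - t) ^+ 2)^-1 =
    (p * m)^-1 * ((1 + F x ^+ 2)^-1 * k).
  have p2 : 0 < p ^+ 2 + m ^+ 2 * (x - t) ^+ 2.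
    by rewrite ltr_wpDr ?exprn_gt0// mulr_ge0 ?sqr_ge0.
  rewrite /F /k; field.
  by rewrite !gt_eqF//= exprMn.
have mf : measurable_fun setT (fun x => (1 + F x ^+ 2)^-1 * k).
  apply: measurable_funM => //.
  apply: (@measurableT_comp _ _ _ _ _ _ (fun x : R => (1 + x ^+ 2)^-1)).
    by apply: continuous_measurable_fun; exact: continuous_oneDsqrV.
  by apply: measurable_funM => //; exact: measurable_funB.
rewrite (funext fE) (mulrC pi).
apply: has_integral_leZ; first by rewrite invr_ge0 mulr_ge0 ?ltW.
split=> //; last by rewrite E.
by move=> x; rewrite mulr_ge0 ?(ltW k0)// invr_ge0 addr_ge0// sqr_ge0.
Qed.

(** * Comparison of sin u with u *)

Lemma sin_mean_value {R : realType} (u : R) :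
  exists2 c, 0 <= c <= `|u| & sin u = cos c * u.
Proof.
have dsin (x : R) : x \in `]0, `|u|[%R -> is_derive x 1 sin (cos x).
  by move=> _; exact: is_derive_sin.
have csin : {within `[0, `|u|], continuous (@sin R)}.
  by apply: continuous_subspaceT; exact: continuous_sin.
have [c cu E] := MVT_segment (normr_ge0 u) dsin csin.
exists c; first by rewrite in_itv in cu.
move: E; rewrite sin0 !subr0; case: (ger0P u) => // _.
by rewrite sinN mulrN => /oppr_inj.
Qed.

Lemma sqr_sin_le {R : realType} (u : R) : sin u ^+ 2 <= u ^+ 2.
Proof.
have [c _ ->] := sin_mean_value u; rewrite exprMn ler_piMl ?sqr_ge0//.
Qed.

(** The mean value point c lies in [0, 1], and cos decreases on [0, pi], so cos c >= cos 1 > 0. *)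
Lemma sqr_sin_ge {R : realType} (u : R) : `|u| <= 1 ->
  (cos 1 * u) ^+ 2 <= sin u ^+ 2.
Proof.
move=> u1; have [c /andP[c0 cu] ->] := sin_mean_value u.
have pi1 : (1 : R) <= pi by have := pihalf_ge1 R; lra.
have c1 : cos 1 <= cos c.
  have c1 := le_trans cu u1.
  by rewrite leNgt ltr_cos -?leNgt// in_itv/= ?c0 ?ler01//= (le_trans c1).
have cos1 := ltW (cos1_gt0 R).
by rewrite 2!exprMn ler_wpM2r ?sqr_ge0// ler_pXn2r ?nnegrE// (le_trans cos1).
Qed.

(** * Squared distance from x to the rotating point R_a y *)

Definition rotx {R : realType} (y1 y2 a : R) := y1 * cos a + y2 * sin a.
Definition roty {R : realType} (y1 y2 a : R) := - y1 * sin a + y2 * cos a.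

Definition sqdist {R : realType} (x1 x2 y1 y2 a : R) :=
  (x1 - rotx y1 y2 a) ^+ 2 + (x2 - roty y1 y2 a) ^+ 2.

Lemma sqdist_ge0 {R : realType} (x1 x2 y1 y2 a : R) :
  0 <= sqdist x1 x2 y1 y2 a.
Proof. by rewrite addr_ge0 ?sqr_ge0. Qed.

(** A chord subtending the angle a - b in a circle of radius rho has length 2 rho |sin ((a - b) /
    2)|. *)
Lemma rot_chord {R : realType} (y1 y2 a b : R) :
  (rotx y1 y2 a - rotx y1 y2 b) ^+ 2 + (roty y1 y2 a - roty y1 y2 b) ^+ 2 =
  4 * (y1 ^+ 2 + y2 ^+ 2) * sin ((a - b) / 2) ^+ 2.
Proof.
set v := (a - b) / 2; pose u := (a + b) / 2.
rewrite (_ : a = u + v); last by rewrite /u /v; field.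
rewrite (_ : b = u - v); last by rewrite /u /v; field.
rewrite /rotx /roty cosD sinD cosB sinB.
by have H := sin2cos2 u; ring: H.
Qed.

Lemma sqdist0 {R : realType} (x1 x2 y1 y2 : R) :
  sqdist x1 x2 y1 y2 0 = (x1 - y1) ^+ 2 + (x2 - y2) ^+ 2.
Proof. by rewrite /sqdist /rotx /roty cos0 sin0; ring. Qed.

Lemma sqr_rot {R : realType} (y1 y2 a : R) :
  rotx y1 y2 a ^+ 2 + roty y1 y2 a ^+ 2 = y1 ^+ 2 + y2 ^+ 2.
Proof. by rewrite /rotx /roty; have H := sin2cos2 a; ring: H. Qed.

Lemma continuous_rotx {R : realType} (y1 y2 : R) : continuous (rotx y1 y2).
Proof.
by move=> a; apply: cvgD; apply: cvgM;
  by [exact: cvg_cst|exact: continuous_cos|exact: continuous_sin].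
Qed.

Lemma continuous_roty {R : realType} (y1 y2 : R) : continuous (roty y1 y2).
Proof.
by move=> a; apply: cvgD; apply: cvgM;
  by [exact: cvg_cst|exact: continuous_cos|exact: continuous_sin].
Qed.

Lemma continuous_sqdist {R : realType} (x1 x2 y1 y2 : R) :
  continuous (sqdist x1 x2 y1 y2).
Proof.
move=> a; apply: cvgD.
  apply: (@cvg_comp _ _ _ (fun a => x1 - rotx y1 y2 a) (fun z : R => z ^+ 2));
    last exact: exprn_continuous.
  by apply: cvgB; [exact: cvg_cst|exact: continuous_rotx].
apply: (@cvg_comp _ _ _ (fun a => x2 - roty y1 y2 a) (fun z : R => z ^+ 2));
  last exact: exprn_continuous.
by apply: cvgB; [exact: cvg_cst|exact: continuous_roty].
Qed.

(** Parallelogram law for x - R_a y and x - R_b y: the defect is the squared norm of their sum. *)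
Lemma chord_le_sqdist {R : realType} (x1 x2 y1 y2 a b : R) :
  4 * (y1 ^+ 2 + y2 ^+ 2) * sin ((a - b) / 2) ^+ 2 <=
  2 * sqdist x1 x2 y1 y2 a + 2 * sqdist x1 x2 y1 y2 b.
Proof.
rewrite -rot_chord /sqdist.
move: (rotx y1 y2 a) (rotx y1 y2 b) (roty y1 y2 a) (roty y1 y2 b) => p q r s.
rewrite -subr_ge0 (_ : _ - _ = (2 * x1 - p - q) ^+ 2 + (2 * x2 - r - s) ^+ 2).
  by rewrite addr_ge0 ?sqr_ge0.
by ring.
Qed.

(** As F(a0) <= F(a), the chord bound gives F(a) >= rho^2 sin^2 ((a - a0) / 2). Both angles lie in
    [-1, 1], so the half-angle does too, and [sqr_sin_ge] yields the constant (cos 1 / 2)^2. *)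
Lemma sqdist_minimizer {R : realType} (x1 x2 y1 y2 : R) :
  exists a0, forall a, `|a| <= 1 ->
    (y1 ^+ 2 + y2 ^+ 2) * (cos 1 / 2) ^+ 2 * (a - a0) ^+ 2 <=
    sqdist x1 x2 y1 y2 a.
Proof.
have cF : {within `[-1, 1], continuous (sqdist x1 x2 y1 y2)}.
  by apply: continuous_subspaceT; exact: continuous_sqdist.
have N11 : (-1 : R) <= 1 by lra.
have [a0 + min] := EVT_min N11 cF.
rewrite in_itv/= -ler_norml => a01; exists a0 => a a1.
have /min Fa : a \in `[-1, 1]%R by rewrite in_itv/= -ler_norml.
have /sqr_sin_ge sinE : `|(a - a0) / 2| <= 1.
  by move: a1 a01; rewrite !ler_norml => /andP[? ?] /andP[? ?]; lra.
have := chord_le_sqdist x1 x2 y1 y2 a a0.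
have rho0 : 0 <= y1 ^+ 2 + y2 ^+ 2 by rewrite addr_ge0 ?sqr_ge0.
have := ler_wpM2l rho0 sinE.
rewrite -[_ * _ * (a - a0) ^+ 2]mulrA -exprMn mulrAC.
rewrite [(cos 1 * (_ / _))]mulrA.
by lra.
Qed.

(** Triangle inequality through R_a y, the chord from y to R_a y being at most the arc rho |a|. *)
Lemma sqdist0_le {R : realType} (x1 x2 y1 y2 a : R) :
  sqdist x1 x2 y1 y2 0 <=
  2 * sqdist x1 x2 y1 y2 a + 2 * (y1 ^+ 2 + y2 ^+ 2) * a ^+ 2.
Proof.
have rho0 : 0 <= y1 ^+ 2 + y2 ^+ 2 by rewrite addr_ge0 ?sqr_ge0.
have := ler_wpM2l rho0 (sqr_sin_le (a / 2)).
have := rot_chord y1 y2 a 0; rewrite subr0 => E S.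
have {}S : (rotx y1 y2 a - rotx y1 y2 0) ^+ 2 +
  (roty y1 y2 a - roty y1 y2 0) ^+ 2 <= (y1 ^+ 2 + y2 ^+ 2) * a ^+ 2.
  by rewrite E; move: S; rewrite expr_div_n; lra.
move: S; rewrite /sqdist.
move: (rotx y1 y2 a) (rotx y1 y2 0) (roty y1 y2 a) (roty y1 y2 0) => p q r s S.
(* With u = x - R_a y and v = R_a y - y this is |u - v|^2, the defect in |u + v|^2 <= 2 |u|^2 + 2
   |v|^2. *)
have : 0 <= (x1 - 2 * p + q) ^+ 2 + (x2 - 2 * r + s) ^+ 2.
  by rewrite addr_ge0 ?sqr_ge0.
by nra.
Qed.

(** * The integral of 1 / |d|^2 *)

Lemma le_inv_of_ge {R : realFieldType} (u v : R) : 0 < v -> v <= u -> u^-1 <= v^-1.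
Proof. by move=> v0 vu; rewrite lef_pV2// posrE (lt_le_trans v0). Qed.

(** Each range of a needs only one summand; the sum of all three is a majorant without case
    distinction. The redundant squares and [a - 0] match the form of [cauchy_has_integral]. *)
Lemma inv_sqdist_le {R : realType} (x1 x2 y1 y2 rho delta : R) :
  0 < rho -> rho ^+ 2 = y1 ^+ 2 + y2 ^+ 2 ->
  0 < delta -> delta ^+ 2 = sqdist x1 x2 y1 y2 0 ->
  exists a0, forall a, (sqdist x1 x2 y1 y2 a + a ^+ 2)^-1 <=
    2 * (1 ^+ 2 + 1 ^+ 2 * (a - 0) ^+ 2)^-1 +
    ((delta / 2) ^+ 2 + 1 ^+ 2 * (a - 0) ^+ 2)^-1 +
    ((delta / (2 * rho)) ^+ 2 + (rho * (cos 1 / 2)) ^+ 2 * (a - a0) ^+ 2)^-1.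
Proof.
move=> rho0 rhoE delta0 deltaE.
have [a0 Ha0] := sqdist_minimizer x1 x2 y1 y2.
exists a0 => a; rewrite expr1n !mul1r !subr0.
have Fa0 := sqdist_ge0 x1 x2 y1 y2 a; have a2 := sqr_ge0 a.
set P := 1 + a ^+ 2; set Q := (_ / 2) ^+ 2 + a ^+ 2; set T := _ + _ * (a - a0) ^+ 2.
have P0 : 0 < P by rewrite ltr_wpDr.
have Q0 : 0 < Q by rewrite ltr_wpDr// exprn_gt0// divr_gt0.
have T0 : 0 < T.
  rewrite ltr_wpDr ?exprn_gt0 ?divr_gt0 ?mulr_gt0//.
  by rewrite mulr_ge0 ?sqr_ge0.
have P'0 : 0 <= 2 * P^-1 by rewrite mulr_ge0// invr_ge0 ltW.
have Q'0 : 0 <= Q^-1 by rewrite invr_ge0 ltW.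
have T'0 : 0 <= T^-1 by rewrite invr_ge0 ltW.
have [a1|a1] := leP `|a| 1; last first.
  suff : (sqdist x1 x2 y1 y2 a + a ^+ 2)^-1 <= 2 * P^-1 by lra.
  have a21 : 1 < a ^+ 2 by rewrite -real_normK ?num_real// exprn_egt1.
  rewrite -[2]invrK -invfM; apply: le_inv_of_ge; first by rewrite mulr_gt0.
  by rewrite /P; lra.
have near0 := sqdist0_le x1 x2 y1 y2 a; rewrite -rhoE -deltaE in near0.
(* Below this threshold [near0] leaves F(a) >= delta^2 / 4. *)
have [ra|ra] := leP (rho ^+ 2 * a ^+ 2) (delta ^+ 2 / 4).
  suff : (sqdist x1 x2 y1 y2 a + a ^+ 2)^-1 <= Q^-1 by lra.
  by apply: le_inv_of_ge => //; rewrite /Q expr_div_n; lra.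
suff : (sqdist x1 x2 y1 y2 a + a ^+ 2)^-1 <= T^-1 by lra.
(* Here F(a) supplies the term in a - a0, and a^2 > delta^2 / (4 rho^2) the constant one. *)
apply: le_inv_of_ge => //; rewrite /T [leLHS]addrC; apply: lerD.
  by rewrite exprMn rhoE; exact: Ha0.
rewrite expr_div_n exprMn ler_pdivrMr ?mulr_gt0 ?exprn_gt0//.
by lra.
Qed.

Lemma inv_sqdist_integral {R : realType} (x1 x2 y1 y2 delta : R) :
  0 < delta -> delta ^+ 2 = sqdist x1 x2 y1 y2 0 ->
  exists2 g : R -> R,
    has_integral_le g (pi * (2 + 4 / cos 1) * (1 + 1 / delta)) &
    forall a, (sqdist x1 x2 y1 y2 a + a ^+ 2)^-1 <= g a.
Proof.
move=> delta0 deltaE; have c0 := cos1_gt0 R; have pi0 := pi_gt0 R.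
(* For y = 0 the third density degenerates, but F >= delta^2 / 2 everywhere and one Cauchy density
   suffices. *)
have [y0|y0] := eqVneq (y1 ^+ 2 + y2 ^+ 2) 0.
  have [g0 g1] : delta / 2 > 0 /\ (1 : R) > 0 by rewrite divr_gt0.
  exists (fun a => ((delta / 2) ^+ 2 + 1 ^+ 2 * (a - 0) ^+ 2)^-1).
    apply: le_has_integral (cauchy_has_integral _ _ 0 g0 g1).
    rewrite -subr_ge0 (_ : _ - _ = pi * (2 + 4 / cos 1 + 4 / cos 1 / delta)).
      by rewrite mulr_ge0 ?(ltW pi0)// !addr_ge0// !divr_ge0// ltW.
    by field; rewrite !gt_eqF.
  move=> a; rewrite expr1n mul1r subr0; apply: le_inv_of_ge.
    by rewrite ltr_wpDr ?sqr_ge0// exprn_gt0.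
  have := sqdist0_le x1 x2 y1 y2 a; rewrite y0 -deltaE expr_div_n.
  by have := sqr_ge0 delta; lra.
pose rho := Num.sqrt (y1 ^+ 2 + y2 ^+ 2).
have rhoE : rho ^+ 2 = y1 ^+ 2 + y2 ^+ 2 by rewrite sqr_sqrtr ?addr_ge0 ?sqr_ge0.
have rho0 : 0 < rho by rewrite sqrtr_gt0 lt_def y0 addr_ge0 ?sqr_ge0.
have [a0 Ha] := inv_sqdist_le _ _ _ _ _ _ rho0 rhoE delta0 deltaE.
eexists; last exact: Ha.
apply: le_has_integral; last first.
  apply: has_integral_leD; last first.
    by apply: cauchy_has_integral; rewrite ?divr_gt0// ?mulr_gt0// divr_gt0.
  apply: has_integral_leD.
    by apply: has_integral_leZ => //; apply: cauchy_has_integral.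
  by apply: cauchy_has_integral; rewrite ?divr_gt0.
(* The masses are 2 pi, 2 pi / delta and 4 pi / (delta cos 1): in the third, rho cancels, which
   makes the bound uniform in y. *)
rewrite -subr_ge0 (_ : _ - _ = pi * (4 / cos 1)).
  by rewrite mulr_ge0 ?(ltW pi0)// divr_ge0// ltW.
by field; rewrite !gt_eqF.
Qed.

(** * Euclidean norms and cross products in coordinates *)

Lemma sqr_enorm {R : realType} n (v : 'rV[R]_n) :
  enorm v ^+ 2 = \sum_(i < n) v 0 i ^+ 2.
Proof. by rewrite sqr_sqrtr// sumr_ge0// => i _; rewrite sqr_ge0. Qed.

Lemma sqr_enorm2 {R : realType} (v : 'rV[R]_2) :
  enorm v ^+ 2 = v 0 0 ^+ 2 + v 0 1 ^+ 2.
Proof.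
rewrite sqr_enorm !big_ord_recl big_ord0 addr0.
by congr (_ ^+ 2 + v 0 _ ^+ 2); apply/val_inj.
Qed.

Lemma sqr_enorm3 {R : realType} (v : 'rV[R]_3) :
  enorm v ^+ 2 = v 0 0 ^+ 2 + v 0 1 ^+ 2 + v 0 2 ^+ 2.
Proof.
rewrite sqr_enorm !big_ord_recl big_ord0 addr0 addrA.
by congr (_ ^+ 2 + v 0 _ ^+ 2 + v 0 _ ^+ 2); apply/val_inj.
Qed.

Lemma ord3_cases (P : 'I_3 -> Prop) : P 0 -> P 1 -> P 2 -> forall k, P k.
Proof.
move=> P0 P1 P2 [[|[|[|//]]] kP].
- by rewrite (_ : Ordinal kP = 0)//; exact/val_inj.
- by rewrite (_ : Ordinal kP = 1)//; exact/val_inj.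
- by rewrite (_ : Ordinal kP = 2)//; exact/val_inj.
Qed.

Lemma vec3E {R : realType} (a b c : R) :
  (vec3 a b c 0 0 = a) * (vec3 a b c 0 1 = b) * (vec3 a b c 0 2 = c).
Proof. by rewrite /vec3 !mxE. Qed.

Lemma vec2E {R : realType} (a b : R) :
  (vec2 a b 0 0 = a) * (vec2 a b 0 1 = b).
Proof. by rewrite /vec2 !mxE. Qed.

(** Each component is a 2 by 2 determinant. By Lagrange's identity the difference of the squared
    sides is a sum of squares, written out for each component. *)
Lemma normr_crossp_le {R : realType} (u v : 'rV[R]_3) k :
  `|crossp u v 0 k| <= enorm u * enorm v.
Proof.
rewrite -ler_sqr ?nnegrE ?mulr_ge0 ?sqrtr_ge0// real_normK ?num_real//.
rewrite exprMn !sqr_enorm3.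
elim/ord3_cases: k; rewrite /crossp !vec3E;
  move: (u 0 0) (u 0 1) (u 0 2) (v 0 0) (v 0 1) (v 0 2) => a b c p q r;
  rewrite -subr_ge0.
- rewrite (_ : _ - _ = (b * q + c * r) ^+ 2 + a ^+ 2 * (p ^+ 2 + q ^+ 2 + r ^+ 2)
     + (b ^+ 2 + c ^+ 2) * p ^+ 2); last by ring.
  by repeat (apply: sqr_ge0 || apply: addr_ge0 || apply: mulr_ge0).
- rewrite (_ : _ - _ = (c * r + a * p) ^+ 2 + b ^+ 2 * (p ^+ 2 + q ^+ 2 + r ^+ 2)
     + (a ^+ 2 + c ^+ 2) * q ^+ 2); last by ring.
  by repeat (apply: sqr_ge0 || apply: addr_ge0 || apply: mulr_ge0).
- rewrite (_ : _ - _ = (b * q + a * p) ^+ 2 + c ^+ 2 * (p ^+ 2 + q ^+ 2 + r ^+ 2)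
     + (b ^+ 2 + a ^+ 2) * r ^+ 2); last by ring.
  by repeat (apply: sqr_ge0 || apply: addr_ge0 || apply: mulr_ge0).
Qed.

Lemma crosspZl {R : realType} (c : R) (u v : 'rV[R]_3) :
  crossp (c *: u) v = c *: crossp u v.
Proof.
apply/rowP => k; rewrite [in RHS]mxE.
by elim/ord3_cases: k; rewrite /crossp !vec3E !mxE; ring.
Qed.

(** The factor 3 is a crude substitute for sqrt 3. *)
Lemma enorm_le {R : realType} (v : 'rV[R]_3) B :
  (forall k, `|v 0 k| <= B) -> enorm v <= 3 * B.
Proof.
move=> vB; have B0 : 0 <= B := le_trans (normr_ge0 _) (vB 0).
have v2 k : v 0 k ^+ 2 <= B ^+ 2.
  by rewrite -(real_normK (num_real _)) ler_pXn2r ?nnegrE.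
rewrite -ler_sqr ?nnegrE ?sqrtr_ge0 ?mulr_ge0// sqr_enorm3 exprMn.
by have := v2 0; have := v2 1; have := v2 2; have := sqr_ge0 B; lra.
Qed.

Lemma bracket_ge1 {R : realType} n (v : 'rV[R]_n) : 1 <= bracket v.
Proof. by rewrite -[1]sqrtr1 ler_sqrt ?lerDl ?sqr_ge0// addr_ge0 ?sqr_ge0. Qed.

Lemma sqr_bracket {R : realType} n (v : 'rV[R]_n) :
  bracket v ^+ 2 = 1 + enorm v ^+ 2.
Proof. by rewrite sqr_sqrtr// addr_ge0 ?sqr_ge0. Qed.

(** * Pointwise bounds and measurability of the integrand *)

(** This is the vector d of the overview; [planar] below is F for row vectors. *)
Definition sep {R : realType} (x y : 'rV[R]_2) (a : R) : 'rV[R]_3 :=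
  lift3 x 0 - lift3 (Defs.rot a y) a.

Definition planar {R : realType} (x y : 'rV[R]_2) (a : R) : R :=
  sqdist (x 0 0) (x 0 1) (y 0 0) (y 0 1) a.

Lemma sepE {R : realType} (x y : 'rV[R]_2) (a : R) :
  (sep x y a 0 0 = x 0 0 - rotx (y 0 0) (y 0 1) a) *
  (sep x y a 0 1 = x 0 1 - roty (y 0 0) (y 0 1) a) *
  (sep x y a 0 2 = - a).
Proof.
have E (u v : 'rV[R]_3) k : (u - v) 0 k = u 0 k - v 0 k by rewrite !mxE.
by rewrite /sep !E /lift3 /Defs.rot !vec3E !vec2E sub0r.
Qed.

Lemma sqr_enorm_sep {R : realType} (x y : 'rV[R]_2) (a : R) :
  enorm (sep x y a) ^+ 2 = planar x y a + a ^+ 2.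
Proof. by rewrite sqr_enorm3 !sepE sqrrN. Qed.

Lemma sqr_enormB {R : realType} (x y : 'rV[R]_2) :
  enorm (x - y) ^+ 2 = planar x y 0.
Proof. by rewrite /planar sqdist0 sqr_enorm2 !mxE. Qed.

Lemma enormB_gt0 {R : realType} (x y : 'rV[R]_2) : x <> y -> 0 < enorm (x - y).
Proof.
move=> xy; rewrite lt_def sqrtr_ge0 andbT -sqrf_eq0 sqr_enorm2.
apply/negP; rewrite paddr_eq0 ?sqr_ge0// !sqrf_eq0 !mxE !subr_eq0.
move=> /andP[/eqP x0 /eqP x1]; apply: xy; apply/rowP => -[[|[|//]] kP].
- by rewrite (_ : Ordinal kP = 0)//; exact/val_inj.
- by rewrite (_ : Ordinal kP = 1)//; exact/val_inj.
Qed.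

Lemma planarD_gt0 {R : realType} (x y : 'rV[R]_2) (a : R) : x <> y ->
  0 < planar x y a + a ^+ 2.
Proof.
move=> /enormB_gt0 xy.
have [->|a0] := eqVneq a 0.
  by rewrite -sqr_enormB ltr_wpDr ?sqr_ge0// exprn_gt0.
by rewrite ltr_wpDl ?sqdist_ge0// exprn_even_gt0.
Qed.

Lemma K_integrandE {R : realType} (x y : 'rV[R]_2) a k :
  K_integrand x y a 0 k =
  (enorm (sep x y a) ^+ 3)^-1 * crossp (sep x y a) (xi (lift3 (Defs.rot a y) a)) 0 k.
Proof. by rewrite /K_integrand -/(sep x y a) crosspZl mxE. Qed.

(** |xi(p)|^2 = 1 + p_1^2 + p_2^2, and rotations preserve the planar norm. *)
Lemma enorm_xi_rot {R : realType} (y : 'rV[R]_2) a :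
  enorm (xi (lift3 (Defs.rot a y) a)) = bracket y.
Proof.
apply/eqP; rewrite -(@eqrXn2 _ 2) ?sqrtr_ge0// sqr_bracket sqr_enorm3 sqr_enorm2.
rewrite -(sqr_rot (y 0 0) (y 0 1) a) /xi /lift3 /Defs.rot !vec3E !vec2E /rotx /roty.
by apply/eqP; ring.
Qed.

(** The cross product is at most |d| <y>, and the factor |d|^-3 turns this into <y> / |d|^2. *)
Lemma normr_K_integrand_le {R : realType} (x y : 'rV[R]_2) a k : x <> y ->
  `|K_integrand x y a 0 k| <= bracket y * (planar x y a + a ^+ 2)^-1.
Proof.
move=> xy; have D0 := planarD_gt0 x y a xy.
rewrite K_integrandE -sqr_enorm_sep in D0 *; set d := sep x y a in D0 *.
have d0 : 0 < enorm d by rewrite lt_def sqrtr_ge0 andbT -sqrf_eq0 gt_eqF.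
rewrite normrM ger0_norm ?invr_ge0 ?exprn_ge0 ?sqrtr_ge0//.
rewrite ler_pdivrMl ?exprn_gt0//; apply: le_trans (normr_crossp_le _ _ _) _.
rewrite enorm_xi_rot le_eqVlt; apply/orP; left; apply/eqP; field.
by rewrite gt_eqF.
Qed.

(* xi is affine, so moving its base point from p to (x, 0) changes it by
   (d_2, - d_1, 0). *)
Lemma normr_K_integrand_le_far {R : realType} (x y : 'rV[R]_2) a k : x <> y ->
  `|K_integrand x y a 0 k| <=
  (bracket x + Num.sqrt (planar x y a)) * (planar x y a + a ^+ 2)^-1.
Proof.
move=> xy; have D0 := planarD_gt0 x y a xy.
rewrite K_integrandE -sqr_enorm_sep in D0 *; set d := sep x y a in D0 *.
have d0 : 0 < enorm d by rewrite lt_def sqrtr_ge0 andbT -sqrf_eq0 gt_eqF.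
rewrite normrM ger0_norm ?invr_ge0 ?exprn_ge0 ?sqrtr_ge0//.
rewrite ler_pdivrMl ?exprn_gt0//.
pose w := vec3 (d 0 1) (- d 0 0) 0.
have -> : crossp d (xi (lift3 (Defs.rot a y) a)) 0 k =
    crossp d (xi (lift3 x 0)) 0 k - crossp d w 0 k.
  by elim/ord3_cases: k; rewrite /crossp /w /xi /lift3 /Defs.rot !vec3E !vec2E
    /d !sepE /rotx /roty; ring.
(* [w] is the horizontal part of d turned by a right angle. *)
have wE : enorm w = Num.sqrt (planar x y a).
  apply/eqP; rewrite -(@eqrXn2 _ 2) ?sqrtr_ge0// sqr_enorm3 sqr_sqrtr ?sqdist_ge0//.
  by rewrite /w !vec3E /d !sepE /planar /sqdist; apply/eqP; ring.
have xE : enorm (xi (lift3 x 0)) = bracket x.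
  apply/eqP; rewrite -(@eqrXn2 _ 2) ?sqrtr_ge0// sqr_bracket sqr_enorm3 sqr_enorm2.
  by rewrite /xi /lift3 !vec3E; apply/eqP; ring.
apply: le_trans (ler_normB _ _) _.
apply: le_trans (lerD (normr_crossp_le _ _ _) (normr_crossp_le _ _ _)) _.
rewrite wE xE le_eqVlt; apply/orP; left; apply/eqP; field.
by rewrite gt_eqF.
Qed.

Lemma measurable_K_integrand {R : realType} (x y : 'rV[R]_2) k : x <> y ->
  measurable_fun setT (fun a => K_integrand x y a 0 k).
Proof.
move=> xy; under eq_fun do rewrite K_integrandE.
have mx : measurable_fun setT (rotx (y 0 0) (y 0 1)).
  by apply: continuous_measurable_fun; exact: continuous_rotx.
have my : measurable_fun setT (roty (y 0 0) (y 0 1)).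
  by apply: continuous_measurable_fun; exact: continuous_roty.
have cN : continuous (fun a => enorm (sep x y a)).
  have -> : (fun a => enorm (sep x y a)) =
      (fun a => Num.sqrt (planar x y a + a ^+ 2)).
    by apply/funext => a; rewrite -sqr_enorm_sep sqrtr_sqr ger0_norm ?sqrtr_ge0.
  move=> a; apply: (@continuous_comp _ _ _ (fun a => planar x y a + a ^+ 2));
    last exact: sqrt_continuous.
  by apply: cvgD; [exact: continuous_sqdist|exact: exprn_continuous].
apply: measurable_funM.
(* As x and y are distinct, d never vanishes, so |d|^-3 is continuous. *)
- apply: continuous_measurable_fun => a; apply: cvgV.
    rewrite expf_neq0// -sqrf_eq0 sqr_enorm_sep gt_eqF//.
    exact: planarD_gt0.
  apply: (@continuous_comp _ _ _ (fun a => enorm (sep x y a)) (fun z : R => z ^+ 3));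
    [exact: cN|exact: exprn_continuous].
- elim/ord3_cases: k; rewrite /crossp /xi /lift3 /Defs.rot.
  + under eq_fun do rewrite !vec3E !vec2E !sepE -/(rotx _ _ _) -/(roty _ _ _).
    by repeat (apply: measurable_funB || apply: measurable_funM ||
      apply: measurable_funN || done).
  + under eq_fun do rewrite !vec3E !vec2E !sepE -/(rotx _ _ _) -/(roty _ _ _).
    by repeat (apply: measurable_funB || apply: measurable_funM ||
      apply: measurable_funN || done).
  + under eq_fun do rewrite !vec3E !vec2E !sepE -/(rotx _ _ _) -/(roty _ _ _).
    by repeat (apply: measurable_funB || apply: measurable_funM ||
      apply: measurable_funN || done).
Qed.

(** * Integration of the pointwise bounds *)

(** Since |x| <= rho / 2, the distance |x - R_a y| lies between rho - |x| and rho + |x|. The squares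
    |2 x - R_a y|^2 and |x + R_a y|^2 control the inner product from either side. *)
Lemma planar_bounds {R : realType} (x y : 'rV[R]_2) (a : R) :
  4 * enorm x ^+ 2 <= enorm y ^+ 2 ->
  (enorm y / 2) ^+ 2 <= planar x y a /\ planar x y a <= (2 * enorm y) ^+ 2.
Proof.
rewrite expr_div_n exprMn !sqr_enorm2 -(sqr_rot (y 0 0) (y 0 1) a).
rewrite /planar /sqdist.
move: (x 0 0) (x 0 1) (rotx _ _ _) (roty _ _ _) => p q r s xy.
have : 0 <= (2 * p - r) ^+ 2 + (2 * q - s) ^+ 2 by rewrite addr_ge0 ?sqr_ge0.
have : 0 <= (p + r) ^+ 2 + (q + s) ^+ 2 by rewrite addr_ge0 ?sqr_ge0.
have : 0 <= r ^+ 2 + s ^+ 2 by rewrite addr_ge0 ?sqr_ge0.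
by split; nra.
Qed.

Lemma normr_Rintegral_K_le {R : realType} (x y : 'rV[R]_2) k : x <> y ->
  `|\int[@lebesgue_measure R]_(a in setT) K_integrand x y a 0 k| <=
  (2 * (pi * (2 + 4 / cos 1)) + 4 * pi) *
  Num.min (bracket y * (1 + 1 / enorm (x - y)))
          (bracket x * (1 + 1 / enorm (x - y))).
Proof.
move=> xy; set L := pi * (2 + 4 / cos 1); set e := 1 + 1 / enorm (x - y).
have d0 := enormB_gt0 x y xy; have pi0 := pi_gt0 R.
have e1 : 1 <= e by rewrite lerDl divr_ge0// ltW.
have L0 : 0 < L by rewrite mulr_gt0// addr_gt0// divr_gt0// cos1_gt0.
have x1 := bracket_ge1 _ x; have y1 := bracket_ge1 _ y.
have mf := measurable_K_integrand x y k xy.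
have [g Ig Hg] := inv_sqdist_integral _ _ _ _ _ d0 (sqr_enormB x y).
rewrite -/L -/e in Ig.
set I := `|_|.
have Iy : I <= L * (bracket y * e).
  have by0 : 0 <= bracket y by apply: le_trans y1.
  rewrite mulrCA; apply: normr_Rintegral_le mf (has_integral_leZ _ _ _ by0 Ig) _.
  move=> a; apply: le_trans (normr_K_integrand_le _ _ _ _ xy) _.
  by apply: ler_wpM2l => //; exact: Hg.
have Le0 : 0 <= L * e by rewrite mulr_ge0 ?(ltW L0)// (le_trans _ e1).
(* The term 2 L covers <y> <= 2 <x> when y is near; for far y, L bounds the main part and 4 pi the
   error from moving xi. *)
have Ix : I <= (2 * L + 4 * pi) * (bracket x * e).
  have [far|near] := leP (4 * enorm x ^+ 2) (enorm y ^+ 2); last first.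
    have yx : bracket y <= 2 * bracket x.
      rewrite -ler_sqr ?nnegrE ?mulr_ge0 ?sqrtr_ge0// exprMn !sqr_bracket.
      by lra.
    apply: (le_trans Iy).
    have : L * e * bracket y <= L * e * (2 * bracket x) by rewrite ler_wpM2l.
    have : 0 <= pi * (bracket x * e).
      by rewrite !mulr_ge0 ?(ltW pi0)// ?(le_trans _ x1)// (le_trans _ e1).
    by lra.
  (* Otherwise the upper bound at a = 0 would force |x - y| = 0. *)
  have r0 : 0 < enorm y.
    have [_] := planar_bounds x y 0 far.
    rewrite -sqr_enormB exprMn; apply: contra_leT; rewrite -leNgt => r0.
    have -> : enorm y = 0 by apply/eqP; rewrite eq_le r0 sqrtr_ge0.
    by rewrite expr0n mulr0 exprn_gt0.
  have bx0 : 0 <= bracket x by apply: le_trans x1.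
  have r2 : 0 < enorm y / 2 by rewrite divr_gt0.
  have r20 : 0 <= 2 * enorm y by rewrite mulr_ge0 ?ltW.
  have I2 := has_integral_leD _ _ _ _ (has_integral_leZ _ _ _ bx0 Ig)
    (has_integral_leZ _ _ _ r20 (cauchy_has_integral _ _ 0 r2 (@ltr01 R))).
  have {}Iy : I <= bracket x * (L * e) + 2 * enorm y * (pi / (enorm y / 2 * 1)).
  { apply: normr_Rintegral_le mf I2 _ => a.
    apply: le_trans (normr_K_integrand_le_far _ _ _ _ xy) _.
    have [F1 F2] := planar_bounds x y a far.
    rewrite mulrDl; apply: lerD; first by apply: ler_wpM2l => //; exact: Hg.
    (* sqrt F <= 2 rho, and |d|^2 >= (rho / 2)^2 + a^2. *)
    apply: ler_pM.
    - exact: sqrtr_ge0.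
    - by rewrite invr_ge0 ltW// planarD_gt0.
    - by rewrite -ler_sqr ?nnegrE ?sqrtr_ge0// sqr_sqrtr// sqdist_ge0.
    - rewrite expr1n mul1r subr0; apply: le_inv_of_ge; last by rewrite lerD2r.
      by rewrite ltr_wpDr ?sqr_ge0// exprn_gt0. }
  have piE : 2 * enorm y * (pi / (enorm y / 2 * 1)) = 4 * pi.
    by field; rewrite gt_eqF.
  rewrite piE in Iy.
  (* Both <x> and [e] are at least 1, so the additive 4 pi is absorbed. *)
  have : pi * 1 <= pi * (bracket x * e).
    by rewrite ler_wpM2l ?(ltW pi0)// mulr_ege1.
  have : 0 <= bracket x * (L * e) by rewrite mulr_ge0.
  by lra.
rewrite minElt; case: ifP => _ //; apply: (le_trans Iy).
rewrite ler_wpM2r//; first by rewrite mulr_ge0 ?(le_trans _ y1)// (le_trans _ e1).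
by lra.
Qed.

Theorem proposition3p1 (R : realType) :
  exists C : R, 0 < C /\
    forall x y : 'rV[R]_2, x <> y ->
      enorm (K x y) <=
        C * Num.min (bracket y * (1 + 1 / enorm (x - y)))
                    (bracket x * (1 + 1 / enorm (x - y))).
Proof.
have pi0 := pi_gt0 R.
have L0 : (0 : R) < 2 * (pi * (2 + 4 / cos 1)) + 4 * pi.
  by rewrite addr_gt0// !mulr_gt0// addr_gt0// divr_gt0// cos1_gt0.
(* The 3 passes from components to the Euclidean norm; the prefactor 1 / (4 pi) is only bounded by
   1. *)
exists (3 * (2 * (pi * (2 + 4 / cos 1)) + 4 * pi)); split; first by rewrite mulr_gt0.
move=> x y xy; rewrite -mulrA; apply: enorm_le => k.
apply: le_trans (normr_Rintegral_K_le x y k xy).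
rewrite /K !mxE normrM normrN ler_piMl//.
rewrite ger0_norm ?divr_ge0 ?mulr_ge0 ?(ltW pi0)//.
rewrite ler_pdivrMr ?mulr_gt0// mul1r.
by have := pihalf_ge1 R; lra.
Qed.
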